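(* Let $\mathcal E$ satisfy the standing energy assumptions and have a clean critical set. Then every Dissipative Viscosity solution $u$ (with atomic set $\mathrm J$) has left and right limits at every time $t\in\mathrm{TD}_0$ (only the right limit at $t=0$ and the left limit at $t=T$). Moreover, $\mathrm{TD}_0\subset\mathsf{SV}(u)$, and $u$ is continuous at every $t\in\mathsf{SV}(u)\setminus\mathrm J$ (in particular at every $t\in\mathrm{TD}_0\setminus\mathrm J$).
   Context: Energy. $\mathsf H$ is a separable Hilbert space with norm $\|\cdot\|$, $T>0$, $\mathsf E\subset\mathsf H$ is convex, $\mathcal E:[0,T]\times\mathsf E\to\mathbb R$, $(t,u)\mapsto\mathcal E_t(u)$ ($+\infty$ off $\mathsf E$). Standing energy assumptions: (coercivity) all sublevels $\{(t,u):\mathcal E_t(u)\le c\}$ are compact in $[0,T]\times\mathsf H$; put $\widetilde{\mathcal E}_t(u):=\mathcal E_t(u)-\min\mathcal E+1$; (time dependence) $\mathcal P_t(u):=\partial_t\mathcal E_t(u)$ exists on $[0,T]\times\mathsf E$, $|\mathcal P_t(u)|\le C_P\widetilde{\mathcal E}_t(u)$, and $\mathcal P_t(u_n)\to\mathcal P_t(u)$ whenever $u_n\to u$ and $\sup_n\mathcal E_t(u_n)<\infty$; ($\lambda$-convexity) there is $\lambda\ge0$ with $u\mapsto\mathcal E_t(u)+\frac\lambda2\|u\|^2$ convex on $\mathsf E$ for every $t$. $\partial\mathcal E_t(u)$ is the Fréchet subdifferential ($\xi\in\partial\mathcal E_t(u)$ iff $\mathcal E_t(v)-\mathcal E_t(u)\ge\langle\xi,v-u\rangle+o(\|v-u\|)$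 as $v\to u$), $\partial\mathcal E_t^\circ(u)$ its minimal-norm element ($\|\partial\mathcal E_t^\circ(u)\|=+\infty$ if empty). $\mathrm C(t):=\{u\in\mathsf E:0\in\partial\mathcal E_t(u)\}$; $\mathrm C(t,x)$ is the connected component of $\mathrm C(t)$ containing $x$. Clean critical set: $\mathcal E_t$ is constant on each connected component of $\mathrm C(t)$, for every $t$. $\mathrm{TD}_0:=\{t\in[0,T]:\mathrm C(t,x)=\{x\}\ \forall x\in\mathrm C(t)\}$. Lifting of $u:[0,T]\to\mathsf E$: $\mathrm U(t):=\mathrm C(t,u(t))$ if $u(t)\in\mathrm C(t)$, $\{u(t)\}$ otherwise; $\mathsf{SV}(u):=\{t:\mathrm U(t)=\{u(t)\}\}$. $\mathfrak E_t$: sets that are connected components of $\mathrm C(t)$ or singletons $\{x\}$, $x\in\mathsf E\setminus\mathrm C(t)$. $\mathrm{Ls}_{s\to t}u(s)$ is the set of all limits of $u(s_k)$ along $s_k\to t$ (similarly one-sided). Cost: for $U_0,U_1\in\mathfrak E_t$ an admissible transition is $\vartheta:[0,1]\to\mathsf E$ with $\vartheta(i)\in U_i$ such that (a) $G_t[\vartheta]:=\{s:\vartheta(s)\notin\mathrm C(t)\}$ is relatively open, $\vartheta$ is locally Lipschitz in it and $\|\partial\mathcal E_t^\circ(\vartheta)\|\|\vartheta'\|\le L$ a.e. there for some $L$; (b) $s\mapsto\mathcal E_t(\vartheta(s))$ is Lipschitz; (c) $\mathrm{Ls}_{s\to r}\vartheta(s)\subset\mathrm C(t,\vartheta(r))$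 for $r\notin G_t[\vartheta]$; $\mathsf c_t(U_0;U_1)$ is the infimum of $\int_{G_t[\vartheta]}\|\partial\mathcal E_t^\circ(\vartheta)\|\|\vartheta'\|ds$ over admissible transitions ($+\infty$ if none). Dissipative Viscosity solution: a Borel map $u:[0,T]\to\mathsf E$ with lifting $\mathrm U$ such that (i) $e(t):=\mathcal E_t(u(t))$ has bounded variation and there is a nonnegative finite Borel measure $\mu$ on $[0,T]$ with $\mu([s,t])+\mathcal E_t(u(t))=\mathcal E_s(u(s))+\int_s^t\mathcal P_r(u(r))dr$ for all $s\le t$ in $[0,T]\setminus\mathrm J$, where $\mathrm J:=\{t:\mu(\{t\})>0\}$ is the jump set of $e$; (ii) for $t\notin\mathrm J$: $u(t)\in\mathrm C(t)$, $\mathrm{Ls}_{s\to t}u(s)\subset\mathrm U(t)$; (iii) for $t\in\mathrm J$ there is a unique pair of connected components $\mathrm U(t\pm)$ of $\mathrm C(t)$ with $\mathrm{Ls}_{s\uparrow t}u(s)\subset\mathrm U(t-)$, $\mathrm{Ls}_{s\downarrow t}u(s)\subset\mathrm U(t+)$, $e(t\pm)=\mathcal E_t(\mathrm U(t\pm))$, $0<\mathsf c_t(\mathrm U(t-);\mathrm U(t+))=\mathsf c_t(\mathrm U(t-);\mathrm U(t))+\mathsf c_t(\mathrm U(t);\mathrm U(t+))=e(t-)-e(t+)=\mu(\{t\})$. Endpoint convention: $e(0-):=e(0)$, $\mathrm U(0-):=\mathrm U(0)$, $e(T+):=e(T)$, $\mathrm U(T+):=\mathrm U(T)$ (not necessarily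 components of the critical set). Such a solution takes values in a compact set $\{v\in\mathsf E:\widetilde{\mathcal E}_t(v)\le\rho\ \forall t\in[0,T]\}$ for some $\rho>0$. *)

(* Defs.v *)
From HB Require Import structures.
From mathcomp Require Import all_boot all_order all_algebra.
From mathcomp Require Import sesquilinear.
From mathcomp Require Import all_classical all_reals all_analysis.
Set Implicit Arguments.
Unset Strict Implicit.
Unset Printing Implicit Defensive.
Import Order.TTheory GRing.Theory Num.Theory.
Import numFieldNormedType.Exports.
Local Open Scope classical_set_scope.
Local Open Scope ring_scope.

Definition separable_space (H : topologicalType) : Prop :=
  exists D : set H, countable D /\ dense D.

(* Upper limit of [u], restricted to [D], at [t]: all limits of [u (s_ k)]
   along sequences [s_ k] in [D] converging to [t]. *)
Definition Ls (R : realType) (H : topologicalType)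
    (D : set R) (u : R -> H) (t : R) : set H :=
  [set v | exists s_ : nat -> R,
     [/\ forall k, D (s_ k), s_ k @[k --> \oo] --> t
       & u (s_ k) @[k --> \oo] --> v]].

Section energy.
Context (R : realType) (H : completeNormedModType R).

(* [En t u] is meaningful only for [t] in [0, T] and [u] in [E]; the value
   +oo off [E] is rendered by restricting every clause to [E].
   [ip] is tied to the norm by a separate hypothesis `|x| ^+ 2 = ip x x. *)
Context (ip : {dot H for idfun}) (T : R) (E : set H) (En : R -> H -> R).

Definition sublevel (c : R) : set (R * H) :=
  [set p | [/\ 0 <= p.1 <= T, E p.2 & En p.1 p.2 <= c]].

(* Under coercivity this infimum is attained. *)
Definition min_energy : R :=
  inf [set r | exists t u, [/\ 0 <= t <= T, E u & r = En t u]].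

Definition shifted_energy (t : R) (u : H) : R := En t u - min_energy + 1.

Definition time_quotient (t : R) (u : H) (s : R) : R :=
  (s - t)^-1 * (En s u - En t u).

(* The time derivative of [En] relative to [0, T], hence one-sided at 0, T. *)
Definition power (t : R) (u : H) : R :=
  lim (time_quotient t u @ within `[0, T]%classic t^').

Record standing_energy : Prop := StandingEnergy {
  domain_convex : convex_set (E : set (convex_lmodType H));
  coercivity : forall c : R, compact (sublevel c);
  power_exists : forall t u, 0 <= t <= T -> E u ->
    cvg (time_quotient t u @ within `[0, T]%classic t^');
  power_bound : exists C_P : R, forall t u, 0 <= t <= T -> E u ->
    `|power t u| <= C_P * shifted_energy t u;
  power_continuous : forall t (u_ : nat -> H) (u : H), 0 <= t <= T ->
    (forall n, E (u_ n)) -> u_ n @[n --> \oo] --> u ->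
    (exists c : R, forall n, En t (u_ n) <= c) ->
    power t (u_ n) @[n --> \oo] --> power t u;
  lambda_convex : exists2 lambda : R, 0 <= lambda &
    forall t, 0 <= t <= T ->
      convex_function (E : set (convex_lmodType H))
        (fun u => En t u + lambda / 2 * `|u : H| ^+ 2)
}.

Definition subdiff (t : R) (u : H) : set H :=
  [set xi | E u /\ forall eps : R, 0 < eps -> \forall v \near u, E v ->
     ip xi (v - u) - eps * `|v - u| <= En t v - En t u].

Definition min_subgrad (t : R) (u : H) : H :=
  xget 0 [set xi | subdiff t u xi /\
                   forall zeta, subdiff t u zeta -> `|xi| <= `|zeta|].

Definition min_subgrad_norm (t : R) (u : H) : \bar R :=
  if `[< subdiff t u = set0 >] then +oo%E else `|min_subgrad t u|%:E.

Definition crit (t : R) : set H := [set u | E u /\ subdiff t u 0].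

(* Empty when [x] is not critical. *)
Definition crit_comp (t : R) (x : H) : set H := connected_component (crit t) x.

Definition is_crit_comp (t : R) (U : set H) : Prop :=
  exists2 x, crit t x & U = crit_comp t x.

Definition clean_critical_set : Prop :=
  forall t x y, 0 <= t <= T -> crit t x -> crit_comp t x y -> En t y = En t x.

Definition TD0 : set R :=
  [set t | 0 <= t <= T /\ forall x, crit t x -> crit_comp t x = [set x]].

Definition lifting (u : R -> H) (t : R) : set H :=
  if `[< crit t (u t) >] then crit_comp t (u t) else [set u t].

Definition SV (u : R -> H) : set R :=
  [set t | 0 <= t <= T /\ lifting u t = [set u t]].

Definition noncrit_times (t : R) (theta : R -> H) : set R :=
  [set s | 0 <= s <= 1 /\ ~ crit t (theta s)].

(* With the convention 0 * +oo = 0. *)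
Definition cost_density (t : R) (theta : R -> H) (s : R) : \bar R :=
  (min_subgrad_norm t (theta s) * `|derive1 theta s|%:E)%E.

Record admissible (t : R) (U0 U1 : set H) (theta : R -> H) : Prop :=
  Admissible {
  adm_domain : forall s, 0 <= s <= 1 -> E (theta s);
  adm_start : U0 (theta 0);
  adm_end : U1 (theta 1);
  adm_open : exists2 O : set R, open O &
    noncrit_times t theta = `[0, 1]%classic `&` O;
  adm_locally_lipschitz :
    [locally [lipschitz theta s | s in noncrit_times t theta]];
  adm_density : exists L : R, {ae (@lebesgue_measure R), forall s,
    noncrit_times t theta s -> (cost_density t theta s <= L%:E)%E};
  adm_energy : [lipschitz (En t (theta s) : R^o) | s in `[0, 1]%classic];
  adm_limits : forall r, 0 <= r <= 1 -> ~ noncrit_times t theta r ->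
    Ls `[0, 1]%classic theta r `<=` crit_comp t (theta r)
}.

(* Only used for [U0] and [U1] that are connected components of [crit t] or
   singletons of noncritical points of [E]. *)
Definition cost (t : R) (U0 U1 : set H) : \bar R :=
  ereal_inf [set (\int[@lebesgue_measure R]_(s in noncrit_times t theta)
                   cost_density t theta s)%E | theta in admissible t U0 U1].

Definition energy_along (u : R -> H) (t : R) : R := En t (u t).

Definition energy_left (u : R -> H) (t : R) : R :=
  if t == 0 then energy_along u 0
  else lim (energy_along u s @[s --> t^'-]).

Definition energy_right (u : R -> H) (t : R) : R :=
  if t == T then energy_along u T
  else lim (energy_along u s @[s --> t^'+]).

Definition is_left_state (u : R -> H) (t : R) (U : set H) : Prop :=
  if t == 0 then U = lifting u 0 else is_crit_comp t U.

Definition is_right_state (u : R -> H) (t : R) (U : set H) : Prop :=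
  if t == T then U = lifting u T else is_crit_comp t U.

Definition jump_set (mu : {finite_measure set (measurableTypeR R) -> \bar R}) :
    set R :=
  [set t | 0 <= t <= T /\ (0 < mu [set t])%E].

Record jump_states (u : R -> H)
    (mu : {finite_measure set (measurableTypeR R) -> \bar R})
    (t : R) (Um Up : set H) : Prop := JumpStates {
  js_left : is_left_state u t Um;
  js_right : is_right_state u t Up;
  js_left_limits : Ls [set s | 0 <= s < t] u t `<=` Um;
  js_right_limits : Ls [set s | t < s <= T] u t `<=` Up;
  js_left_energy : forall v, Um v -> En t v = energy_left u t;
  js_right_energy : forall v, Up v -> En t v = energy_right u t;
  js_cost_gt0 : (0 < cost t Um Up)%E;
  js_cost_split :
    cost t Um Up = (cost t Um (lifting u t) + cost t (lifting u t) Up)%E;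
  js_cost_energy : cost t Um Up = (energy_left u t - energy_right u t)%:E;
  js_cost_atom : cost t Um Up = mu [set t]
}.

(* A Borel measure on [0, T] is a Borel measure on the line that does not
   charge the complement of [0, T]. *)
Record dissipative_viscosity (u : R -> H)
    (mu : {finite_measure set (measurableTypeR R) -> \bar R}) : Prop :=
  DissipativeViscosity {
  dv_domain : forall t, 0 <= t <= T -> E (u t);
  dv_borel : measurable_fun (`[0, T]%classic : set (measurableTypeR R))
    (u : measurableTypeR R -> g_sigma_algebraType (@open H));
  dv_bv : bounded_variation 0 T (energy_along u);
  dv_support : mu (~` `[0, T]%classic) = 0%E;
  dv_balance : forall s t, 0 <= s -> s <= t -> t <= T ->
    ~ jump_set mu s -> ~ jump_set mu t ->
    (mu `[s, t]%classic + (energy_along u t)%:E =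
     (energy_along u s)%:E +
     \int[@lebesgue_measure R]_(r in `[s, t]) (power r (u r))%:E)%E;
  dv_regular : forall t, 0 <= t <= T -> ~ jump_set mu t ->
    crit t (u t) /\ Ls `[0, T]%classic u t `<=` lifting u t;
  dv_jump : forall t, jump_set mu t ->
    exists! p : set H * set H, jump_states u mu t p.1 p.2
}.

End energy.

(* Main.v *)
(* The energy of [u] has bounded variation, so by coercivity [u] takes values
   in a compact set. Hence [u s] converges along a filter tending to [t] as soon
   as all sequential limits of [u] at [t] are one and the same point. At a jump
   time, one-sided limits lie in a component of the critical set; at any other
   time, limits lie in the lifting of [u]. These sets are singletons when [t]
   is in [TD0], and so is the lifting when [t] is in [SV]. *)
Require Import Defs.
From HB Require Import structures.
From mathcomp Require Import all_boot all_order all_algebra.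
From mathcomp Require Import sesquilinear.
From mathcomp Require Import all_classical all_reals all_analysis.
Set Implicit Arguments.
Unset Strict Implicit.
Unset Printing Implicit Defensive.
Import Order.TTheory GRing.Theory Num.Theory.
Import numFieldNormedType.Exports.
Local Open Scope classical_set_scope.
Local Open Scope ring_scope.

(** Balls of radius [1 / (k + 1)] form a countable base of neighbourhoods, so choosing one time for
    each [k] turns a cluster point into a sequential limit. *)
Lemma cluster_Ls (R : realType) (H : normedModType R) (D : set R)
    (u : R -> H) (t : R) (G : set_system R) {GF : Filter G} :
    G --> t -> G D ->
  cluster (u @ G) `<=` Ls D u t.
Proof.
move=> Gt GD v clv.
have pick k : exists s, [/\ D s, ball t k.+1%:R^-1 s & ball v k.+1%:R^-1 (u s)].
  have k0 : 0 < k.+1%:R^-1 :> R by rewrite invr_gt0.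
  have Gk : G (D `&` ball t k.+1%:R^-1).
    by apply: filterI => //; apply: Gt; exact: nbhsx_ballx.
  have Guk : (u @ G) (u @` (D `&` ball t k.+1%:R^-1)).
    by apply: (@filterS _ G _ _ _ _ Gk) => s Ds; exists s.
  have [_ [[s [Ds ts] <-] vs]] := clv _ _ Guk (nbhsx_ballx v _ k0).
  by exists s.
have [s_ s_P] := choice pick.
(* Needed twice: for the times, with [M] the line, and for the values in [H]. *)
have ball_cvg (M : normedModType R) (x : M) (x_ : nat -> M) :
    (forall k, ball x k.+1%:R^-1 (x_ k)) -> x_ k @[k --> \oo] --> x.
  move=> xx; apply/cvg_ballP => _/posnumP[e].
  near=> k; apply: le_ball (xx k); apply/ltW.
  by near: k; exact: near_infty_natSinv_lt.
by exists s_; split; [|apply: (ball_cvg R^o)|apply: ball_cvg] => k;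
  have [] := s_P k.
Unshelve. all: by end_near. Qed.

Lemma cvg_of_Ls_sub1 (R : realType) (H : normedModType R)
    (D : set R) (K : set H) (u : R -> H) (t : R) (l : H)
    (G : set_system R) {GF : Filter G} :
    G --> t -> G D ->
    compact K -> (forall s, D s -> K (u s)) -> Ls D u t `<=` [set l] ->
  u @ G --> l.
Proof.
move=> Gt GD cK uK Lsl A nA; apply: contrapT => nGA.
(* Away from [A] the filter would still have a cluster point, which can only
   be [l], although [A] is a neighbourhood of [l]. *)
pose G' := within (~` (u @^-1` A)) G.
(* An empty member of [G'] would put the preimage of [A] in [G], against [nGA]. *)
have G'F : ProperFilter G'.
  apply: Build_ProperFilter_ex => B; apply: contraPP.
  move=> /forallNP nB; rewrite /G' /within /= => GB.
  by apply: nGA; apply: filterS GB => s sB; apply: contrapT => /sB /nB.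
have GG' B : G B -> G' B by apply: filterS.
have G'K : (u @ G') K by apply: GG'; apply: filterS GD.
have [p [_ clp]] := cK _ (fmap_proper_filter _ G'F) G'K.
have pl : p = l.
  by apply: Lsl; apply: cluster_Ls clp => [B /Gt|]; exact: GG'.
have nG'A : (u @ G') (~` A) by rewrite /fmap /= /G' /within /=; exact: nearW.
by have [|x []] := clp _ A nG'A; rewrite ?pl.
Qed.

Lemma bounded_variation_has_ubound (R : realType) (a b : R) (f : R -> R) :
    bounded_variation a b f ->
  exists c, forall x, a <= x <= b -> f x <= c.
Proof.
(* The maximum settles [x = a] without discussing the sign of [M]. For [x > a], the increment
   [f x - f a] is at most the variation along a partition through [x]. *)
move=> [M Mub]; exists (Num.max (f a) (f a + M)) => x /andP[].
rewrite le_max le_eqVlt => /predU1P[<-|ax xb]; first by rewrite lexx.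
apply/orP; right; rewrite -lerBlDl; apply: le_trans (ler_norm _) _.
(* Partition nodes increase strictly, so [x = b] calls for [[:: b]] instead of [[:: x; b]]. *)
move: xb; rewrite le_eqVlt => /predU1P[xb|xb].
  apply: (@le_trans _ _ (variation a b f [:: b])).
    by rewrite /variation /= big_nat1 /= xb.
  by apply: Mub; exists [:: b] => //; apply: itv_partition1; rewrite -xb.
apply: (@le_trans _ _ (variation a b f [:: x; b])).
  by rewrite /variation /= big_nat_recl //= lerDl sumr_ge0.
by apply: Mub; exists [:: x; b] => //; split => //=; rewrite ax xb.
Qed.

Section dissipative_viscosity_solutions.
Context (R : realType) (H : completeNormedModType R).
Context (ip : {dot H for idfun}) (T : R) (E : set H) (En : R -> H -> R).
Context (hEn : standing_energy T E En).
Context (u : R -> H) (mu : {finite_measure set (measurableTypeR R) -> \bar R}).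
Context (hu : dissipative_viscosity ip T E En u mu).

Lemma dissipative_viscosity_compact_range :
  exists2 K : set H, compact K & forall t, 0 <= t <= T -> K (u t).
Proof.
have [c uc] := bounded_variation_has_ubound (dv_bv hu).
(* Coercivity gives compactness jointly in time and state; projecting to [H] yields one compact set
   valid for all times. *)
exists (snd @` sublevel T E En c).
  apply: continuous_compact; last exact: coercivity hEn c.
  by apply: continuous_subspaceT => x; exact: cvg_snd.
move=> t tT; exists (t, u t) => //; split => //=.
  exact: dv_domain hu _ tT.
exact: uc.
Qed.

Lemma dissipative_viscosity_cvg (D : set R) (t : R) (l : H)
    (G : set_system R) {GF : Filter G} :
    G --> t -> G D -> D `<=` [set s | 0 <= s <= T] ->
    Ls D u t `<=` [set l] ->
  u @ G --> l.
Proof.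
move=> Gt GD DT Lsl; have [K cK uK] := dissipative_viscosity_compact_range.
by apply: (cvg_of_Ls_sub1 Gt GD cK) => // s /DT; exact: uK.
Qed.

(** When [u t] is not critical its lifting is a singleton by definition, so only critical [u t] is
    at stake. *)
Lemma TD0_sub_SV : TD0 ip T E En `<=` SV ip T E En u.
Proof.
move=> t [tT tdt]; split => //; rewrite /lifting; case: asboolP => //.
exact: tdt.
Qed.

(** The filter is arbitrary so as to cover both one-sided limits and continuity relative to
    [[0, T]]. *)
Lemma SV_cvg (t : R) (G : set_system R) {GF : Filter G} :
    (SV ip T E En u `\` jump_set T mu) t ->
    G --> t -> G `[0, T]%classic ->
  u @ G --> u t.
Proof.
move=> [[tT tSV] tJ] Gt GT.
have [_] := dv_regular hu tT tJ; rewrite tSV => Lsut.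
by apply: (dissipative_viscosity_cvg Gt GT _ Lsut) => s /=; rewrite in_itv.
Qed.

Lemma TD0_left_limit (t : R) : TD0 ip T E En t -> 0 < t ->
  cvg (u s @[s --> t^'-]).
Proof.
move=> tTD t0; have [/andP[_ tT] tdt] := tTD.
have inD : t^'- [set s | 0 <= s < t].
  near=> s; apply/andP; split; last by near: s; exact: nbhs_left_lt.
  by near: s; exact: nbhs_left_ge.
have DT : [set s | 0 <= s < t] `<=` [set s | 0 <= s <= T].
  by move=> s /= /andP[-> /ltW /le_trans]; apply.
have tt : t^'- --> t by exact: cvg_within.
have [tJ|tJ] := pselect (jump_set T mu t); apply/cvg_ex.
  have [[Um Up] [/= jst _]] := dv_jump hu tJ.
  (* Since [0 < t], the endpoint convention does not apply: [Um] is a critical component, hence the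
     single point [x], which may differ from [u t]. *)
  have := js_left jst; rewrite /is_left_state gt_eqF // => -[x tx Umx].
  exists x; apply: (dissipative_viscosity_cvg tt inD DT).
  by rewrite -(tdt x tx) -Umx; exact: js_left_limits jst.
exists (u t); apply: SV_cvg => //; first by split=> //; exact: TD0_sub_SV.
by apply: filterS inD => s /DT; rewrite /= in_itv.
Unshelve. all: by end_near. Qed.

Lemma TD0_right_limit (t : R) : TD0 ip T E En t -> t < T ->
  cvg (u s @[s --> t^'+]).
Proof.
move=> tTD t0; have [/andP[tT _] tdt] := tTD.
have inD : t^'+ [set s | t < s <= T].
  near=> s; apply/andP; split; first by near: s; exact: nbhs_right_gt.
  by near: s; exact: nbhs_right_le.
have DT : [set s | t < s <= T] `<=` [set s | 0 <= s <= T].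
  by move=> s /= /andP[/ltW /(le_trans tT) -> ->].
have tt : t^'+ --> t by exact: cvg_within.
have [tJ|tJ] := pselect (jump_set T mu t); apply/cvg_ex.
  have [[Um Up] [/= jst _]] := dv_jump hu tJ.
  (* Here [t < T] rules out the endpoint convention, under which [Up] could fail to be a critical
     component. *)
  have := js_right jst; rewrite /is_right_state lt_eqF // => -[x tx Upx].
  exists x; apply: (dissipative_viscosity_cvg tt inD DT).
  by rewrite -(tdt x tx) -Upx; exact: js_right_limits jst.
exists (u t); apply: SV_cvg => //; first by split=> //; exact: TD0_sub_SV.
by apply: filterS inD => s /DT; rewrite /= in_itv.
Unshelve. all: by end_near. Qed.

End dissipative_viscosity_solutions.

Theorem proposition4p7 (R : realType) (H : completeNormedModType R)
    (ip : {dot H for idfun}) (T : R) (E : set H) (En : R -> H -> R)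
    (hip : forall x : H, `|x| ^+ 2 = ip x x)
    (hsep : separable_space H)
    (hT : 0 < T)
    (hEn : standing_energy T E En)
    (hclean : clean_critical_set ip T E En)
    (u : R -> H) (mu : {finite_measure set (measurableTypeR R) -> \bar R})
    (hu : dissipative_viscosity ip T E En u mu) :
  [/\ forall t, TD0 ip T E En t ->
        (0 < t -> cvg (u s @[s --> t^'-])) /\
        (t < T -> cvg (u s @[s --> t^'+])),
      TD0 ip T E En `<=` SV ip T E En u,
      forall t, (SV ip T E En u `\` jump_set T mu) t ->
        u s @[s --> within `[0, T]%classic (nbhs t)] --> u t
    & forall t, (TD0 ip T E En `\` jump_set T mu) t ->
        u s @[s --> within `[0, T]%classic (nbhs t)] --> u t].
Proof.
have cont t : (SV ip T E En u `\` jump_set T mu) t ->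
    u s @[s --> within `[0, T]%classic (nbhs t)] --> u t.
  by move=> tSV; apply: (SV_cvg hEn hu tSV); [exact: cvg_within|exact: withinT].
split=> [t tTD|||t [tTD tJ]].
- split; first exact: (TD0_left_limit hEn hu tTD).
  exact: (TD0_right_limit hEn hu tTD).
- exact: TD0_sub_SV.
- exact: cont.
- by apply: cont; split=> //; exact: TD0_sub_SV.
Qed.
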